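(* Left unitary $k$-translatable groupoids of the same order are isomorphic. That is, if $(Q,\cdot)$ and $(G,* )$ are left unitary $k$-translatable groupoids (for the same $k$) of the same order $n$, then $(Q,\cdot)$ and $(G,* )$ are isomorphic.
   Context: A groupoid is a set with a binary operation $\cdot$. For an integer $x$, $[x]_n$ denotes the residue of $x$ modulo $n$, represented in $\{1,\ldots,n\}$, with $0$ identified with $n$. For $1\le k<n$, a groupoid $Q$ of order $n$ is $k$-translatable with respect to an ordering $q_1,\ldots,q_n$ of its elements if in its multiplication table (rows and columns listed in this order) each row is obtained from the preceding one by cyclically shifting it $k$ places to the right, i.e. $q_i\cdot q_j=q_{i-1}\cdot q_{[j-k]_n}$ for all $j$ and all $2\le i\le n$. It is left unitary (with respect to this ordering) if $q_1$ is a left neutral element, i.e. $q_1\cdot x=x$ for all $x$. ''Left unitary $k$-translatable'' means both properties hold with respect to the same ordering. *)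

(* Defs.v *)
From mathcomp Require Import all_boot all_order all_algebra.

Set Implicit Arguments.
Unset Strict Implicit.
Unset Printing Implicit Defensive.

Import Order.TTheory GRing.Theory Num.Theory.

(* An ordering q_1, ..., q_n of Q is a bijection q : 'I_n -> Q, with 0-based
   indices: q_(i+1) is [q i].  Under this relabelling the residue [x]_n in
   {1, ..., n}, with 0 identified with n, becomes the usual residue of x in
   {0, ..., n-1}. *)

Lemma res_subproof n (j : 'I_n) (x : int) : `|(x %% n%:Z)%Z|%N < n.
Proof.
have n_gt0 : (0 < n%:Z)%R by case: n j => [[]|].
by rewrite -ltz_nat gez0_abs ?ltz_pmod // modz_ge0 // gt_eqF.
Qed.

Definition shift_index n (k : nat) (j : 'I_n) : 'I_n :=
  Ordinal (res_subproof j (j%:Z - k%:Z)%R).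

Local Open Scope group_scope.

(* For 0 < i, [ord_pred i] is the index i - 1. *)
Definition translatable_wrt n (k : nat) (Q : magmaType) (q : 'I_n -> Q) : Prop :=
  forall i j : 'I_n, 0 < i -> q i * q j = q (ord_pred i) * q (shift_index k j).

Definition left_unitary_wrt n (Q : magmaType) (q : 'I_n -> Q) : Prop :=
  forall i : 'I_n, i = 0 :> nat -> forall x : Q, q i * x = x.

Definition left_unitary_translatable (n k : nat) (Q : magmaType) : Prop :=
  exists q : 'I_n -> Q,
    [/\ bijective q, translatable_wrt k q & left_unitary_wrt q].

Definition magma_isomorphic (Q G : magmaType) : Prop :=
  exists f : {multiplicative Q -> G}, bijective f.

(* Main.v *)
Require Import Defs.
From HB Require Import structures.
From mathcomp Require Import all_boot all_order all_algebra.

(** Translatability expresses row [i] of the multiplication table through row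
    [i - 1], so the whole table is determined by row [0].  When the first
    element is left neutral, row [0] is the ordering itself, hence every product is
    [q i * q j = q (iter i (shift_index k) j)] ([mul_left_unitary_translatable]):
    in terms of indices the operation depends on [n] and [k] only.  Matching
    the two orderings index by index is therefore an isomorphism. *)

Local Open Scope group_scope.

(** Induction on the row [i]: going down one row shifts the column index once,
    and row [0] is that of a left neutral element. *)
Lemma mul_left_unitary_translatable {n k : nat} {Q : magmaType}
    {q : 'I_n -> Q} :
  translatable_wrt k q -> left_unitary_wrt q ->
  forall i j : 'I_n, q i * q j = q (iter i (shift_index k) j).
Proof.
move=> trq luq [i lt_i_n]; elim: i lt_i_n => [|i IHi] lt_i_n j /=.
  exact: luq.
have lt_i'_n : (i < n)%N by apply: ltnW.
have predE : ord_pred (Ordinal lt_i_n) = Ordinal lt_i'_n.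
  by apply: val_inj; rewrite /= modnDr modn_small.
by rewrite trq // predE IHi /= -iterSr.
Qed.

(** Both magmas are transports of [op] along bijections, so [g] after the inverse
    of [q] is an isomorphism. *)
Lemma magma_isomorphic_of_indexing {I : Type} {Q G : magmaType}
    {op : I -> I -> I} {q : I -> Q} {g : I -> G} :
  bijective q -> bijective g ->
  (forall i j, q i * q j = q (op i j)) ->
  (forall i j, g i * g j = g (op i j)) ->
  magma_isomorphic Q G.
Proof.
move=> [q' qK q'K] bij_g mul_q mul_g.
pose f := g \o q'.
have f_mul : {morph f : x y / x * y}.
  by move=> x y; rewrite /f /= -{1}[x]q'K -{1}[y]q'K mul_q qK mul_g.
pose fM := isMultiplicative.Build Q G f f_mul.
pose F : {multiplicative Q -> G} := HB.pack f fM.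
by exists F; apply: bij_comp bij_g _; exists q.
Qed.

Local Close Scope group_scope.

Theorem theorem3p1 (n k : nat) (Q G : magmaType) :
  1 <= k < n ->
  left_unitary_translatable n k Q ->
  left_unitary_translatable n k G ->
  magma_isomorphic Q G.
Proof.
move=> _ [q [bij_q trq luq]] [g [bij_g trg lug]].
exact: (magma_isomorphic_of_indexing bij_q bij_g
  (mul_left_unitary_translatable trq luq)
  (mul_left_unitary_translatable trg lug)).
Qed.
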